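(* Let $n,k\in\mathbb N$ with $n>2k$, let $\mu_1,\mu_2\in\mathbb N_0$, and set $\hat k=(\mu_2+1)k$. Let $\gamma$ be a primitive element of a finite field $\mathbb F=\mathbb F_{p^N}$ with $N$ sufficiently large. For $j=0,\dots,\mu_1$ define $$\mathfrak G_j:=\begin{bmatrix}\gamma^{2^{jn}}&\cdots&\gamma^{2^{jn+\hat k-1}}\\ \vdots&&\vdots\\ \gamma^{2^{(j+1)n-1}}&\cdots&\gamma^{2^{(j+1)n+\hat k-2}}\end{bmatrix}\in\mathbb F^{n\times\hat k}$$ (the entry in row $r$, column $c$, with $r=0,\dots,n-1$, $c=0,\dots,\hat k-1$, is $\gamma^{2^{jn+r+c}}$), and define $G_l^{(1)}(z_1)\in\mathbb F[z_1]^{n\times k}$, $l=0,\dots,\mu_2$, by $$\mathfrak G^{(1)}(z_1):=[G_0^{(1)}(z_1),\dots,G_{\mu_2}^{(1)}(z_1)]:=\sum_{j=0}^{\mu_1}\mathfrak G_jz_1^j.$$ Let $G(z_1,z_2)=\sum_{l=0}^{\mu_2}G_l^{(1)}(z_1)z_2^l=\sum_{i=0}^{\mu_1}\sum_{l=0}^{\mu_2}G_{il}z_1^iz_2^l$ with $G_{il}\in\mathbb F^{n\times k}$. Then one has the following properties: (1) $[G_s^{(1)}(z_1),\dots,G_l^{(1)}(z_1)]$ for $0\le s\le l\le\mu_2$ generate MDP convolutional codes; (2) the matrix $[G_{00},G_{10},\dots,G_{\mu_10},G_{01},G_{11},\dots,G_{\mu_11},\dots,G_{0\mu_2},\dots,G_{\mu_1\mu_2}]$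 has nonzero full size minors; (3) $G_{\mu_1\mu_2}$ is of full rank, i.e. $m_\alpha=\deg_{z_\alpha}v(z_1,z_2)+\mu_\alpha\le\deg_{z_\alpha}\hat v(z_1,z_2)+\mu_\alpha$ for $\alpha\in\{1,2\}$.
   Context: A (1D) $(n,\kappa)$ convolutional code over $\mathbb F$ is an $\mathbb F[z]$-submodule $\mathcal D\subset\mathbb F[z]^n$ of rank $\kappa$; a full column rank $M(z)\in\mathbb F[z]^{n\times\kappa}$ generates $\mathcal D=\{M(z)w:w\in\mathbb F[z]^\kappa\}$, and the degree $\delta$ of $\mathcal D$ is the maximal degree of the $\kappa\times\kappa$ minors of $M(z)$. Column distances: $d_j^c(\mathcal D)=\min\{\sum_{t=0}^jwt(w_t):\sum_tw_tz^t\in\mathcal D,\ w_0\ne0\}$, with $wt$ the Hamming weight. $\mathcal D$ is MDP (has maximum distance profile) if $d_j^c(\mathcal D)=(n-\kappa)(j+1)+1$ for $j=0,\dots,L:=\lfloor\delta/\kappa\rfloor+\lfloor\delta/(n-\kappa)\rfloor$. Full size minors of an $r\times c$ matrix are its minors of size $\min(r,c)$. The 2D convolutional code generated by $G(z_1,z_2)$ is $\{Gu:u\in\mathbb F[z_1,z_2]^k\}$. In (3), $u(z_1,z_2)\in\mathbb F[z_1,z_2]^k$ is the message, $m_\alpha$ is its degree with respect to $z_\alpha$, $v=Gu$ is the sent codeword, $\mu_\alpha=\deg_{z_\alpha}G$, and $\hat v(z_1,z_2)=\sum_{0\le i\le d_1,\,0\le j\le d_2}\hat v_{ij}z_1^iz_2^j$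 is the word received over an erasure channel, i.e. each component of each $\hat v_{ij}$ equals the corresponding component of $v_{ij}$ or is marked as erased; its degree with respect to $z_\alpha$ is $d_\alpha$.
   Formalization: (1) is asserted only if (l−s+1)k<n, where MDP is defined; (2) only if k̂≤n or μ_1=0, since otherwise two columns coincide; in (3) the sign is corrected to m_α=deg v−μ_α≤deg v̂−μ_α, for u≠0, with erased components counted as nonzero in deg v̂. *)

(* Defs.v *)
From HB Require Import structures.
From mathcomp Require Import all_boot all_order all_algebra all_field.

Set Implicit Arguments.
Unset Strict Implicit.
Unset Printing Implicit Defensive.

Import Order.TTheory GRing.Theory Num.Theory.
Local Open Scope ring_scope.

(* Row and column selections are strictly increasing index maps, so that
   the minors of A are the \det (mxsub f g A). *)
Definition increasing (a b : nat) (f : 'I_a -> 'I_b) : bool :=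
  [forall x : 'I_a, forall y : 'I_a, (x < y)%N ==> (f x < f y)%N].

Definition nonzero_full_size_minors (F : fieldType) (a b : nat)
    (A : 'M[F]_(a, b)) : Prop :=
  forall (f : 'I_(minn a b) -> 'I_a) (g : 'I_(minn a b) -> 'I_b),
    increasing f -> increasing g -> \det (mxsub f g A) != 0.

Section ConvolutionalCodes.

Variables (F : fieldType) (n : nat).

Definition conv_code (kappa : nat) (M : 'M[{poly F}]_(n, kappa)) :
    'cV[{poly F}]_n -> Prop :=
  fun w => exists u : 'cV[{poly F}]_kappa, w = M *m u.

(* The rank of a polynomial matrix is its rank over the field F(z). *)
Definition full_column_rank (kappa : nat) (M : 'M[{poly F}]_(n, kappa)) : Prop :=
  \rank (map_mx (@tofrac {poly F}) M) = kappa.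

(* Zero minors contribute (size 0).-1 = 0, hence do not affect the maximum. *)
Definition conv_degree (kappa : nat) (M : 'M[{poly F}]_(n, kappa)) : nat :=
  \max_(f : {ffun 'I_kappa -> 'I_n} | increasing f)
     (size (\det (rowsub f M))).-1.

Definition hamming_wt (x : 'cV[F]_n) : nat := #|[set r | x r 0 != 0]|.

Definition vcoef (t : nat) (w : 'cV[{poly F}]_n) : 'cV[F]_n :=
  map_mx (fun q : {poly F} => q`_t) w.

Definition truncated_wt (j : nat) (w : 'cV[{poly F}]_n) : nat :=
  \sum_(t < j.+1) hamming_wt (vcoef t w).

Definition is_column_distance (D : 'cV[{poly F}]_n -> Prop) (j d : nat) : Prop :=
  (exists w, [/\ D w, vcoef 0 w != 0 & truncated_wt j w = d]) /\
  (forall w, D w -> vcoef 0 w != 0 -> (d <= truncated_wt j w)%N).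

(* [kappa] and [delta] are the rank and the degree of D. *)
Definition MDP (D : 'cV[{poly F}]_n -> Prop) (kappa delta : nat) : Prop :=
  forall j : nat, (j <= delta %/ kappa + delta %/ (n - kappa))%N ->
    is_column_distance D j ((n - kappa) * j.+1 + 1).

Definition generates_MDP_code (kappa : nat) (M : 'M[{poly F}]_(n, kappa)) : Prop :=
  full_column_rank M /\ MDP (conv_code M) kappa (conv_degree M).

End ConvolutionalCodes.

(* F[z1, z2] is {poly {poly F}}: z1 is the variable of the coefficients and
   z2 the outer variable, so the coefficient of z1^i z2^l in q is q`_l`_i. *)
Section Bivariate.

Variable F : fieldType.

Definition coef2 (a b : nat) (i l : nat) (A : 'M[{poly {poly F}}]_(a, b)) :
    'M[F]_(a, b) :=
  map_mx (fun q : {poly {poly F}} => q`_l`_i) A.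

(* Degrees of a vector; both are 0 on the zero vector. *)
Definition degz1 (a : nat) (v : 'cV[{poly {poly F}}]_a) : nat :=
  \max_(r < a) (sizeY (v r ord0)).-1.

Definition degz2 (a : nat) (v : 'cV[{poly {poly F}}]_a) : nat :=
  \max_(r < a) (size (v r ord0)).-1.

(* A received word: [vh i j r] is component r of the coefficient of z1^i z2^j,
   with None for an erasure. *)
Definition received_word (a : nat) := nat -> nat -> 'I_a -> option F.

Definition erasure_of (a : nat) (v : 'cV[{poly {poly F}}]_a)
    (vh : received_word a) : Prop :=
  forall i j r, vh i j r = None \/ vh i j r = Some (coef2 i j v r ord0).

(* An erased component is unknown and counts as a nonzero one: a coefficient
   is absent from the received word only when it is known to vanish. *)
Definition has_degz1 (a : nat) (vh : received_word a) (d : nat) : Prop :=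
  (exists j r, vh d j r <> Some 0) /\
  (forall i j r, (d < i)%N -> vh i j r = Some 0).

Definition has_degz2 (a : nat) (vh : received_word a) (d : nat) : Prop :=
  (exists i r, vh i d r <> Some 0) /\
  (forall i j r, (d < j)%N -> vh i j r = Some 0).

End Bivariate.

Section Construction.

Variables (F : fieldType) (n k mu1 mu2 : nat) (gamma : F).

Definition khat : nat := (mu2.+1 * k)%N.

Definition frakG (j : nat) : 'M[F]_(n, khat) :=
  \matrix_(r < n, c < khat) gamma ^+ (2 ^ (j * n + r + c)).

Definition frakG1 : 'M[{poly F}]_(n, khat) :=
  \sum_(j < mu1.+1) 'X^j *: map_mx polyC (frakG j).

Lemma block_col_subproof (l : 'I_mu2.+1) (c : 'I_k) : (l * k + c < khat)%N.
Proof.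
apply: (@leq_trans (l.+1 * k)); first by rewrite mulSn addnC ltn_add2r.
by rewrite leq_mul2r ltn_ord orbT.
Qed.

Definition block_col (l : 'I_mu2.+1) (c : 'I_k) : 'I_khat :=
  Ordinal (block_col_subproof l c).

Definition G1 (l : 'I_mu2.+1) : 'M[{poly F}]_(n, k) :=
  \matrix_(r < n, c < k) frakG1 r (block_col l c).

(* [G1_s, ..., G1_l], for s <= l. *)
Definition G1_blocks (s l : 'I_mu2.+1) :
    'M[{poly F}]_(n, \sum_(i < (l - s).+1) k) :=
  \mxrow_(i < (l - s).+1) G1 (inord (s + i)).

Definition G2D : 'M[{poly {poly F}}]_(n, k) :=
  \sum_(l < mu2.+1) 'X^l *: map_mx polyC (G1 l).

Definition Gcoef (i l : nat) : 'M[F]_(n, k) := coef2 i l G2D.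

(* [G_00, G_10, ..., G_{mu1 0}, G_01, ..., G_{mu1 mu2}]. *)
Definition Gcoef_row :
    'M[F]_(n, \sum_(l < mu2.+1) \sum_(i < mu1.+1) k) :=
  \mxrow_(l < mu2.+1) \mxrow_(i < mu1.+1) Gcoef i l.

End Construction.

(* Main.v *)
Require Import Defs.
From HB Require Import structures.
From mathcomp Require Import all_boot all_order all_algebra all_field.
From mathcomp Require Import fingroup perm zify.

Set Implicit Arguments.
Unset Strict Implicit.
Unset Printing Implicit Defensive.

Import Order.TTheory GRing.Theory Num.Theory.
Local Open Scope ring_scope.

(** Every minor that matters has entries 0 or gamma^(2^e), where the nonzero
    entries form a staircase and e is strictly monotone along rows and columns.
    As a polynomial in gamma it has a unique Leibniz term of least degree, the
    diagonal one: any other supported permutation has an inversion, and undoing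
    it stays inside the staircase and lowers the degree, since
    2^a + 2^b < 2^c + 2^d whenever a, b < d. (The term of largest degree need
    not be unique.) This polynomial has coefficients in the prime field, so
    if it vanished at gamma it would vanish at the N conjugates gamma^(p^i),
    which is impossible once N exceeds its degree.

    A codeword whose truncated weight is too small for the first time at j has
    (j+1)kappa zeros whose rows in the sliding matrix form such a minor, which
    forces the information symbols to vanish. For (3), a matrix whose leading
    coefficient matrix is injective adds its degree to that of any vector. *)

(** * Determinants of staircase matrices of monomials *)

(** The least index moved by [s] moves up, and its preimage lies above it. *)
Lemma perm_inversion m (s : 'S_m) :
  s != 1%g -> exists i i' : 'I_m, (i < i')%N /\ (s i' < s i)%N.
Proof.
move=> s_neq1; have [i0 i0P] : exists i, s i != i.
  apply/existsP; apply: contraR s_neq1; rewrite negb_exists => /forallP fixs.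
  by apply/eqP/permP => i; rewrite perm1; apply/eqP; have := fixs i; rewrite negbK.
case: (@arg_minnP _ i0 (fun i => s i != i) (fun i => val i) i0P) => i si_neq imin.
have fix_below (l : 'I_m) : (l < i)%N -> s l = l.
  by move=> l_lt; apply/eqP; case: (eqVneq (s l) l) => // /imin; rewrite leqNgt l_lt.
have lt_si : (i < s i)%N.
  rewrite ltn_neqAle val_eqE eq_sym si_neq leqNgt; apply/negP => lt_i.
  by have /perm_inj e := fix_below _ lt_i; rewrite e eqxx in si_neq.
exists i, (s^-1%g i); rewrite permKV; split => //.
rewrite ltn_neqAle val_eqE; apply/andP; split.
  by apply: contraNneq si_neq => {1}->; rewrite permKV.
rewrite leqNgt; apply/negP => /fix_below; rewrite permKV => e.
by rewrite {1}e permKV eqxx in si_neq.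
Qed.

Section StaircaseDeterminant.

Variables (R : comNzRingType) (m : nat).
Variables (S : 'I_m -> 'I_m -> bool) (w : 'I_m -> 'I_m -> nat).
Hypothesis S_diag : forall i, S i i.
Hypothesis exchange : forall i i' l l' : 'I_m, (i < i')%N -> (l < l')%N ->
  S i l' -> S i' l ->
  [/\ S i l, S i' l' & (w i l + w i' l' < w i l' + w i' l)%N].

Definition staircase_mx : 'M[{poly R}]_m :=
  \matrix_(i, l) (if S i l then 'X^(w i l) else 0).

Let supp (s : 'S_m) := [forall i, S i (s i)].
Let wt (s : 'S_m) := (\sum_i w i (s i))%N.

Lemma staircase_swap (s : 'S_m) :
  supp s -> s != 1%g -> exists2 t, supp t & (wt t < wt s)%N.
Proof.
move=> /forallP suppS /perm_inversion[i [i' [lt_ii' lt_s]]].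
have neq_ii' : i' != i by rewrite -val_eqE gtn_eqF.
have := exchange lt_ii' lt_s (suppS i) (suppS i').
move=> [S1 S2 lt_w]; exists (tperm i i' * s)%g.
  by apply/forallP => j; rewrite permM; case: tpermP => [->|->|].
rewrite /wt (bigD1 i) //= (bigD1 i') //= [X in (_ < X)%N](bigD1 i) //=.
rewrite [X in (_ < _ + X)%N](bigD1 i') //= !permM tpermL tpermR !addnA.
rewrite -addSn leq_add // leq_eqVlt; apply/orP; left; apply/eqP.
by apply: eq_bigr => j /andP[ji ji']; rewrite permM tpermD // eq_sym.
Qed.

(** Each swap strictly lowers the weight and stays in the support, so the descent ends, and only the
    identity can end it. *)
Lemma staircase_min (s : 'S_m) :
  supp s -> s != 1%g -> (\sum_i w i i < wt s)%N.
Proof.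
have -> : (\sum_i w i i)%N = wt 1%g by apply: eq_bigr => i _; rewrite perm1.
elim: {s}_.+1 {-2}s (ltnSn (wt s)) => // b IH s s_le suppS s1.
have [t suppT lt_t] := staircase_swap suppS s1.
have [<- //|t1] := eqVneq t 1%g.
by apply: ltn_trans (lt_t); apply: IH => //; apply: leq_trans lt_t _.
Qed.

(** No other Leibniz term reaches down to the degree of the diagonal one, so nothing cancels it,
    whatever the characteristic. *)
Lemma coef_det_staircase : (\det staircase_mx)`_(\sum_i w i i) = 1.
Proof.
rewrite /determinant coef_sum (bigD1 1%g) //= odd_perm1 expr0 mul1r.
rewrite (eq_bigr (fun i => 'X^(w i i))); last first.
  by move=> i _; rewrite mxE perm1 S_diag.
rewrite prodrXr coefXn eqxx big1 ?addr0 // => s s1.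
have [suppS|] := boolP (supp s); last first.
  rewrite negb_forall => /existsP[i /negPf Si].
  by rewrite (bigD1 i) //= mxE Si mul0r mulr0 coef0.
rewrite (eq_bigr (fun i => 'X^(w i (s i)))); last first.
  by move=> i _; rewrite mxE (forallP suppS).
rewrite prodrXr -signr_odd; have := staircase_min suppS s1.
case: (odd _); rewrite ?expr0 ?expr1 ?mulN1r ?mul1r ?coefN coefXn /wt;
  by move=> lt_w; rewrite ltn_eqF // oppr0.
Qed.

End StaircaseDeterminant.

Lemma size_det_leq (R : comNzRingType) m d (A : 'M[{poly R}]_m) :
  (forall i l, size (A i l) <= d.+1)%N -> (size (\det A) <= (m * d).+1)%N.
Proof.
move=> sizeA; apply: leq_trans (size_sum _ _ _) _; apply/bigmax_leqP => s _.
have -> : (-1) ^+ s * \prod_i A i (s i) =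
          ((-1) ^+ s)%:P * \prod_i A i (s i) by rewrite rmorphXn rmorphN1.
rewrite mul_polyC; apply: leq_trans (size_scale_leq _ _) _.
apply: leq_trans (size_poly_prod_leq _ _) _.
rewrite card_ord leq_subLR.
apply: (@leq_trans (\sum_(i < m) d.+1).+1).
  by rewrite ltnS leq_sum.
by rewrite sum_nat_const card_ord mulnS addnS.
Qed.

(** * Nonvanishing at a primitive element *)

Section PrimitiveElement.

Variables (F : finFieldType) (p N : nat) (gamma : F).
Hypotheses (hp : prime p) (hN : (1 < N)%N) (cardF : #|F| = (p ^ N)%N).
Hypothesis prim : (#|F|.-1).-primitive_root gamma.

Let charF : p \in [pchar F] := card_finPcharP cardF hp.

(* The conjugates gamma^(p^i), i < N, are pairwise distinct roots of P. *)
Lemma root_prim_size (P : {poly F}) :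
  map_poly (pFrobenius_aut charF) P = P -> P != 0 -> root P gamma ->
  (N < size P)%N.
Proof.
move=> fixP P0 rootP.
have rootX i : root P (gamma ^+ (p ^ i)).
  elim: i => [|i IH]; first by rewrite expn0 expr1.
  have := rmorph_root (pFrobenius_aut charF) IH.
  by rewrite fixP /= pFrobenius_autE -exprM -expnSr.
have p1 : (1 < p)%N by apply: prime_gt1.
(* Exponents below the order of [gamma] give distinct powers; [1 < N] excludes p = 2, N = 1, where
   the order is 1. *)
have lt_pN i : (i < N)%N -> (p ^ i < (p ^ N).-1)%N.
  move=> iN; have le1 : (p ^ i <= p ^ N.-1)%N by rewrite leq_exp2l //; lia.
  have : (p ^ N = p * p ^ N.-1)%N by rewrite -expnS; congr (_ ^ _)%N; lia.
  have : (p <= p ^ N.-1)%N by rewrite -{1}(expn1 p) leq_exp2l //; lia.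
  nia.
have := @max_poly_roots _ P [seq gamma ^+ (p ^ i) | i <- iota 0 N] P0.
rewrite size_map size_iota; apply.
  by apply/allP => x /mapP[i _ ->].
rewrite map_inj_in_uniq ?iota_uniq // => i i'.
rewrite !mem_iota !add0n /= => iN i'N /eqP.
rewrite (eq_prim_root_expr prim) cardF !modn_small ?lt_pN // => /eqP.
by move/(expnI p1).
Qed.

(** The determinant has degree at most [m * D] in [gamma], hence fewer roots than the N conjugates
    that Frobenius invariance would force. *)
Lemma det_staircase_prim_neq0 m D (S : 'I_m -> 'I_m -> bool)
    (w : 'I_m -> 'I_m -> nat) :
  (m * D < N)%N ->
  (forall i l, S i l -> w i l <= D)%N ->
  (forall i, S i i) ->
  (forall i i' l l' : 'I_m, (i < i')%N -> (l < l')%N -> S i l' -> S i' l ->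
    [/\ S i l, S i' l' & (w i l + w i' l' < w i l' + w i' l)%N]) ->
  \det (\matrix_(i, l) (if S i l then gamma ^+ (w i l) else 0)) != 0.
Proof.
move=> mD wD Sd exch.
set A := staircase_mx F S w.
have coefA : (\det A)`_(\sum_i w i i) = 1 by apply: coef_det_staircase.
have A0 : \det A != 0.
  by apply: contra_eq_neq coefA => ->; rewrite coef0 eq_sym oner_eq0.
have sizeA : (size (\det A) <= N)%N.
  apply: leq_trans mD; apply: size_det_leq => i l; rewrite mxE.
  by case: ifP => [/wD|]; rewrite ?size_polyXn ?size_poly0.
have fixA : map_poly (pFrobenius_aut charF) (\det A) = \det A.
  rewrite -det_map_mx; congr (\det _); apply/matrixP => i l; rewrite !mxE.
  by case: ifP => _; rewrite ?rmorph0 //= map_polyXn.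
have -> : \matrix_(i, l) (if S i l then gamma ^+ (w i l) else 0) =
          map_mx (horner_eval gamma) A.
  apply/matrixP => i l; rewrite !mxE /horner_eval.
  by case: ifP => _; rewrite ?hornerXn ?horner0.
rewrite det_map_mx; apply: contraTN sizeA => rootA.
by rewrite -ltnNge; apply: root_prim_size.
Qed.

End PrimitiveElement.

(** * Minors whose entries are iterated squares of [gamma] *)

(** [2 ^ a] and [2 ^ b] are each at most half of [2 ^ d]; the positive [2 ^ c] makes the inequality
    strict. *)
Lemma expn2_exchange a b c d :
  (a < d)%N -> (b < d)%N -> (2 ^ a + 2 ^ b < 2 ^ c + 2 ^ d)%N.
Proof.
move=> ad bd; have c0 : (0 < 2 ^ c)%N by rewrite expn_gt0.
have := leq_pexp2l (isT : (0 < 2)%N) ad; have := leq_pexp2l (isT : (0 < 2)%N) bd.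
by rewrite !expnS; lia.
Qed.

(** Permuting columns preserves nonvanishing of a determinant. Decreasing column exponents against
    increasing row exponents put the largest exponent of every 2 by 2 submatrix in its lower left
    corner, as the exchange condition demands. *)
Lemma exists_sorting_perm m (q : 'I_m -> nat) : injective q ->
  exists s : 'S_m, forall l l' : 'I_m, (l < l')%N -> (q (s l') < q (s l))%N.
Proof.
move=> q_inj; pose t := sort (relpre q geq) (enum 'I_m).
have size_t : size t = m by rewrite size_sort size_enum_ord.
have uniq_t : uniq t by rewrite sort_uniq enum_uniq.
have f_inj : injective (fun l : 'I_m => nth l t l).
  move=> l l' /=; rewrite (set_nth_default l l') ?size_t // => /eqP.
  by rewrite nth_uniq ?size_t // => /eqP/val_inj.
exists (perm f_inj) => l l' ll'; rewrite !permE.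
have sorted_t : sorted (relpre q geq) t by apply: sort_sorted => x y; exact: leq_total.
have := @sorted_ltn_nth _ (relpre q geq) _ l t sorted_t l l'.
move=> /(_ (fun y x z h1 h2 => leq_trans h2 h1)).
rewrite !inE size_t !ltn_ord => /(_ isT isT ll') /= le_q.
rewrite ltn_neqAle (set_nth_default l l') ?size_t // le_q andbT.
apply: contraTneq ll' => /q_inj/eqP.
by rewrite nth_uniq ?size_t // => /eqP ->; rewrite ltnn.
Qed.

Section MinorsOfPowers.

Variables (F : finFieldType) (p N : nat) (gamma : F).
Hypotheses (hp : prime p) (hN : (1 < N)%N) (cardF : #|F| = (p ^ N)%N).
Hypothesis prim : (#|F|.-1).-primitive_root gamma.

(** The case of full support. It serves the minors in (2), the rank in (3) and the top block of
    M(0). *)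
Lemma det_expn2_neq0 m E (r q : 'I_m -> nat) :
  (m * 2 ^ E < N)%N -> (forall i l, r i + q l <= E)%N ->
  (forall i i' : 'I_m, (i < i')%N -> (r i < r i')%N) -> injective q ->
  \det (\matrix_(i, l) gamma ^+ (2 ^ (r i + q l))) != 0.
Proof.
move=> mE rqE r_incr q_inj; have [s q_decr] := exists_sorting_perm q_inj.
set A := \matrix_(i, l) _.
suff : \det (col_perm s A) != 0.
  by rewrite col_permE det_mulmx; apply: contraNneq => ->; rewrite mul0r.
have -> : col_perm s A =
    \matrix_(i, l) (if true then gamma ^+ (2 ^ (r i + q (s l))) else 0).
  by apply/matrixP => i l; rewrite !mxE.
apply: (det_staircase_prim_neq0 hp hN cardF prim mE (S := fun _ _ => true)
  (w := fun i l => (2 ^ (r i + q (s l)))%N)) => //.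
  by move=> i l _; rewrite leq_pexp2l.
move=> i i' l l' ii' ll' _ _; have := r_incr _ _ ii'; have := q_decr _ _ ll'.
by split=> //; apply: expn2_exchange; lia.
Qed.

End MinorsOfPowers.

Lemma rank_rowsub_leq (F : fieldType) a b c (f : 'I_c -> 'I_a) (A : 'M[F]_(a, b)) :
  (\rank (rowsub f A) <= \rank A)%N.
Proof. by rewrite -[A]mul1mx -mul_rowsub_mx mul1mx mxrankM_maxr. Qed.

Lemma sum_divmod (V : nmodType) j k (G : nat -> nat -> V) : (0 < k)%N ->
  \sum_(c < j * k) G (c %/ k)%N (c %% k)%N = \sum_(b < j) \sum_(c < k) G b c.
Proof.
move=> k0; rewrite -(big_mkord xpredT (fun c => G (c %/ k)%N (c %% k)%N)).
rewrite big_nat_mul big_mkord; apply: eq_bigr => b _.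
rewrite -{1}[(b * k)%N]add0n big_addn mulSn addnK big_mkord.
by apply: eq_bigr => c _; rewrite addnC divnMDl // modnMDl divn_small // modn_small // addn0.
Qed.

(** * Positions of the zero coordinates of a codeword *)

Section Codewords.

Variables (F : fieldType) (n : nat) (n_gt0 : (0 < n)%N).

(* The coefficient vectors w_0, w_1, ... of w, concatenated. *)
Definition flat_coef (w : 'cV[{poly F}]_n) (x : nat) : F :=
  (w (Ordinal (ltn_pmod x n_gt0)) ord0)`_(x %/ n).

Lemma truncated_wtE j w :
  truncated_wt j w = count (fun x => flat_coef w x != 0) (iota 0 (j.+1 * n)).
Proof.
rewrite -(subn0 (j.+1 * n)%N) -sum1_count big_mkcond /= big_mkord; pose G t r :=
  if (w (Ordinal (ltn_pmod r n_gt0)) ord0)`_t != 0 then 1%N else 0%N.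
have eqG (c : 'I_(j.+1 * n)) :
    (if flat_coef w c != 0 then 1%N else 0%N) = G (c %/ n)%N (c %% n)%N.
  rewrite /G /flat_coef; congr (if (w _ _)`_ _ != 0%R then _ else _).
  by apply: val_inj; rewrite /= modn_mod.
rewrite (eq_bigr _ (fun c _ => eqG c)) (@sum_divmod nat) //.
apply: eq_bigr => t _; rewrite /hamming_wt -sum1_card big_mkcond.
apply: eq_bigr => r _; rewrite inE mxE /G.
by congr (if (w _ _)`_ _ != 0%R then _ else _); apply: val_inj; rewrite /= modn_small.
Qed.

(* If the truncated weights first violate the bound at j, the zero coordinates
   are late enough, and there are enough of them, for the corresponding
   minor of the sliding matrix to have a nonzero diagonal. *)
Lemma zero_positions kappa mu j (w : 'cV[{poly F}]_n) : (0 < kappa < n)%N ->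
  ((n - kappa) * j <= n * mu)%N ->
  (forall i, (i < j)%N -> ((n - kappa) * i.+1 < truncated_wt i w)%N) ->
  (truncated_wt j w <= (n - kappa) * j.+1)%N ->
  exists f : 'I_(j.+1 * kappa) -> nat,
  [/\ forall q q' : 'I_(j.+1 * kappa), (q < q')%N -> (f q < f q')%N,
      forall q, (f q < j.+1 * n)%N /\ flat_coef w (f q) = 0
    & forall q : 'I_(j.+1 * kappa), (q %/ kappa <= f q %/ n <= q %/ kappa + mu)%N].
Proof.
move=> /andP[kappa0 kappan] jmu good bad.
(* [s i] lists the zero coordinates in the first [i] blocks; the witness enumerates the first
   [j.+1 * kappa] entries of [s j.+1]. *)
pose Z x := flat_coef w x == 0; pose s i := filter Z (iota 0 (i * n)).
have size_s i : (size (s i.+1) + truncated_wt i w = i.+1 * n)%N.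
  by rewrite truncated_wtE size_filter count_predC size_iota.
have sorted_s : sorted ltn (s j.+1).
  by rewrite sorted_filter ?iota_ltn_sorted //; apply: ltn_trans.
have size_sj : (j.+1 * kappa <= size (s j.+1))%N by have := size_s j; nia.
have f_incr q q' : (q < q')%N -> (q' < size (s j.+1))%N ->
    (nth 0 (s j.+1) q < nth 0 (s j.+1) q')%N.
  move=> qq' q's; apply: (sorted_ltn_nth ltn_trans 0 sorted_s) => //.
  by rewrite inE (ltn_trans qq').
have f_mem q : (q < size (s j.+1))%N ->
    (nth 0 (s j.+1) q < j.+1 * n)%N /\ flat_coef w (nth 0 (s j.+1) q) = 0.
  by move/(mem_nth 0); rewrite mem_filter mem_iota => /andP[/eqP -> /andP[]].
exists (fun q => nth 0 (s j.+1) q); split=> [q q' qq'|q|q].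
- by apply: f_incr => //; apply: leq_trans size_sj.
- by apply: f_mem; apply: leq_trans size_sj.
have n0 : (0 < n)%N by lia.
have qlt : (q < size (s j.+1))%N by apply: leq_trans size_sj.
rewrite leq_divRL //; apply/andP; split.
  (* The bound at [i] leaves fewer than [i.+1 * kappa] zeros in the first [i.+1] blocks, so the zero
     numbered [q] comes later. *)
  case E: (q %/ kappa)%N => [//|i].
  have ij : (i < j)%N.
    have : (q %/ kappa < j.+1)%N by rewrite ltn_divLR.
    by rewrite E.
  have qi : (i.+1 * kappa <= q)%N by rewrite -E leq_divM.
  have le_si : (size (s i.+1) <= q)%N.
    by have := size_s i; have := good i ij; rewrite mulnBl (mulnC n) (mulnC kappa); lia.
  have sE : s j.+1 = s i.+1 ++ filter Z (iota (i.+1 * n) ((j - i) * n)).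
    rewrite /s -filter_cat -{2}[(i.+1 * n)%N]add0n -iotaD -mulnDl.
    by congr (filter _ (iota 0 (_ * _))); lia.
  have : nth 0 (s j.+1) q \in filter Z (iota (i.+1 * n) ((j - i) * n)).
    rewrite sE nth_cat ltnNge le_si /=; apply: mem_nth.
    by rewrite ltn_subLR // -size_cat -sE.
  by rewrite mem_filter mem_iota => /andP[_ /andP[]].
(* With b = [q %/ kappa], at least (j - b) kappa zeros follow the one numbered [q] and must fit
   below (j + 1) n. A start at (b + mu + 1) n or later would force n mu < (n - kappa) (j - b),
   against the hypothesis on [j]. *)
rewrite -ltnS ltn_divLR // ltnNge; apply/negP => late.
have tail d : (q + d < size (s j.+1))%N ->
    (nth 0 (s j.+1) q + d <= nth 0 (s j.+1) (q + d))%N.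
  elim: d => [|d IH] lt_d; first by rewrite !addn0.
  have := f_incr (q + d)%N (q + d.+1)%N; rewrite !addnS ltnSn => /(_ isT).
  by rewrite addnS in lt_d => /(_ lt_d); have := IH (ltnW lt_d); lia.
have lt_last : (j.+1 * kappa).-1 = (q + ((j.+1 * kappa).-1 - q))%N.
  by have := ltn_ord q; lia.
have last_lt : ((j.+1 * kappa).-1 < size (s j.+1))%N by nia.
have := tail ((j.+1 * kappa).-1 - q)%N; rewrite -lt_last => /(_ last_lt).
have [+ _] := f_mem _ last_lt.
have q_lt : (q < (q %/ kappa).+1 * kappa)%N by apply: ltn_ceil.
have := ltn_ord q; have : (q %/ kappa < j.+1)%N by rewrite ltn_divLR.
move: late q_lt; move: (q %/ kappa)%N => b late q_lt.
move: (nth _ _ _) (nth _ _ _) late => y y' late bj qm y'lt yy'.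
nia.
Qed.

End Codewords.

Lemma det_neq0_injective (R : idomainType) m (A : 'M[R]_m) (x : 'cV[R]_m) :
  \det A != 0 -> A *m x = 0 -> x = 0.
Proof.
move=> detA Ax; have : (\adj A *m A) *m x = 0 by rewrite -mulmxA Ax mulmx0.
rewrite mul_adj_mx mul_scalar_mx => e; apply/matrixP => i l.
by move/matrixP/(_ i l)/eqP: e; rewrite !mxE mulf_eq0 (negPf detA) => /eqP.
Qed.

(** * The MDP property of codes with exponential coefficients *)

Section ExponentialCode.

Variables (F : finFieldType) (p N : nat) (gamma : F).
Hypotheses (hp : prime p) (hN : (1 < N)%N) (cardF : #|F| = (p ^ N)%N).
Hypothesis prim : (#|F|.-1).-primitive_root gamma.

Variables (n kappa mu a : nat) (M : 'M[{poly F}]_(n, kappa)).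
Hypothesis kappan : (0 < kappa < n)%N.
Hypothesis coefM : forall r c i, (M r c)`_i =
  if (i <= mu)%N then gamma ^+ (2 ^ (i * n + r + c + a)) else 0.
Hypothesis N_large :
  ((n * mu).+1 * kappa * 2 ^ (mu * n + n + kappa + a) < N)%N.

Let kappa_gt0 : (0 < kappa)%N. Proof. by case/andP: kappan. Qed.
Let n_gt0 : (0 < n)%N. Proof. by case/andP: kappan; lia. Qed.
Let le_kappan : (kappa <= n)%N. Proof. by case/andP: kappan; lia. Qed.

(* Row x and column y of the sliding generator matrix, with the columns of each
   block in reverse order, so that the exponents decrease along the rows. *)
Definition sliding_entry (x y : nat) : F :=
  if (y %/ kappa <= x %/ n <= y %/ kappa + mu)%N
  then gamma ^+ (2 ^ ((x %/ n - y %/ kappa) * n + x %% n + (kappa - (y %% kappa).+1) + a))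
  else 0.

(** The block bounds on [f] put the diagonal in the support, and [j <= n * mu] bounds the size of
    the minor, so that one N serves all such j. *)
Lemma det_sliding_neq0 j (f : 'I_(j.+1 * kappa) -> nat) :
  (j <= n * mu)%N ->
  (forall q q' : 'I_(j.+1 * kappa), (q < q')%N -> (f q < f q')%N) ->
  (forall q : 'I_(j.+1 * kappa), (q %/ kappa <= f q %/ n <= q %/ kappa + mu)%N) ->
  \det (\matrix_(q, c < j.+1 * kappa) sliding_entry (f q) c) != 0.
Proof.
move=> jmu f_incr f_diag.
pose S (q c : 'I_(j.+1 * kappa)) :=
  (c %/ kappa <= f q %/ n <= c %/ kappa + mu)%N.
pose e (q c : 'I_(j.+1 * kappa)) :=
  ((f q %/ n - c %/ kappa) * n + f q %% n + (kappa - (c %% kappa).+1) + a)%N.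
(* Moving the block offset to the left avoids its truncated subtraction and makes monotonicity
   linear arithmetic. *)
have eE q c : S q c -> (e q c + (c %/ kappa) * n = f q + (kappa - (c %% kappa).+1) + a)%N.
  move=> /andP[le_cq _]; rewrite /e.
  have := divn_eq (f q) n; have := leq_mul2r n (c %/ kappa) (f q %/ n).
  by rewrite le_cq orbT mulnBl; lia.
have -> : \matrix_(q, c < j.+1 * kappa) sliding_entry (f q) c =
    \matrix_(q, c) (if S q c then gamma ^+ (2 ^ e q c) else 0).
  by apply/matrixP => q c; rewrite !mxE.
apply: (det_staircase_prim_neq0 hp hN cardF prim (S := S)
  (w := fun q c => (2 ^ e q c)%N) (D := (2 ^ (mu * n + n + kappa + a))%N)) => //.
- by apply: leq_ltn_trans N_large; rewrite !leq_mul2r ltnS jmu !orbT.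
- move=> q c /andP[le1 le2]; rewrite leq_pexp2l // /e leq_add2r.
  rewrite !leq_add //; last 2 first.
  + by rewrite ltnW // ltn_pmod.
  + exact: leq_subr.
  by rewrite leq_mul2r leq_subLR le2 orbT.
move=> q q' c c' qq' cc' Sqc' Sq'c.
have le_c : (c %/ kappa <= c' %/ kappa)%N by rewrite leq_div2r // ltnW.
have le_q : (f q %/ n <= f q' %/ n)%N by rewrite leq_div2r // ltnW // f_incr.
(* The support is a band in block indices that are monotone in the row and in the column, so two
   antidiagonal corners inside it bring in the diagonal ones. *)
have [Sqc Sq'c'] : S q c /\ S q' c'.
  by move: Sqc' Sq'c; rewrite /S => /andP[? ?] /andP[? ?]; split; lia.
split=> //.
(* Within a block the reversed order lowers the exponent; passing to a later block loses at least
   [n] and regains less than [kappa]. *)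
have lt_col q0 : S q0 c -> S q0 c' -> (e q0 c' < e q0 c)%N.
  move=> /eE E1 /eE E2.
  have := divn_eq c kappa; have := divn_eq c' kappa.
  have := ltn_pmod c kappa_gt0; have := ltn_pmod c' kappa_gt0.
  move: le_c E1 E2; move: (c %/ kappa)%N (c' %/ kappa)%N => b b'.
  move: (c %% kappa)%N (c' %% kappa)%N (e _ _) (e _ _) => r r' e1 e2.
  rewrite leq_eqVlt => /orP[/eqP <-|bb']; first lia.
  have : (b.+1 * n <= b' * n)%N by rewrite leq_mul2r bb' orbT.
  by rewrite mulSn; lia.
have lt_row : (e q c < e q' c)%N.
  by have := eE _ _ Sqc; have := eE _ _ Sq'c; have := f_incr _ _ qq'; lia.
by apply: expn2_exchange; rewrite ?lt_col.
Qed.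

Let rev_flat_coef (u : 'cV[{poly F}]_kappa) (y : nat) : F :=
  (u (rev_ord (Ordinal (ltn_pmod y kappa_gt0))) ord0)`_(y %/ kappa).

(** Coefficient t of [M *m u] depends only on the coefficients of [u] up to t, so the first [j.+1]
    column blocks suffice. *)
Lemma flat_coef_mulmx (u : 'cV[{poly F}]_kappa) j x : (x < j.+1 * n)%N ->
  flat_coef n_gt0 (M *m u) x =
  \sum_(c < j.+1 * kappa) sliding_entry x c * rev_flat_coef u c.
Proof.
move=> xlt; have xj : (x %/ n < j.+1)%N by rewrite ltn_divLR.
pose G b c := (if (b <= x %/ n <= b + mu)%N
  then gamma ^+ (2 ^ ((x %/ n - b) * n + x %% n + (kappa - c.+1) + a)) else 0) *
  (u (rev_ord (Ordinal (ltn_pmod c kappa_gt0))) ord0)`_b.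
transitivity (\sum_(c < j.+1 * kappa) G (c %/ kappa)%N (c %% kappa)%N); last first.
  apply: eq_bigr => c _; rewrite /G /sliding_entry /rev_flat_coef.
  by congr (_ * (u (rev_ord _) _)`_ _); apply: val_inj; rewrite /= modn_mod.
rewrite sum_divmod // exchange_big /= /flat_coef mxE coef_sum (reindex_inj rev_ord_inj) /=.
apply: eq_bigr => c _; rewrite coefMr.
rewrite (big_ord_widen_cond j.+1 xpredT
  (fun b => (M (Ordinal (ltn_pmod x n_gt0)) (rev_ord c))`_(x %/ n - b) *
    (u (rev_ord c) ord0)`_b)) //.
rewrite big_mkcond /=; apply: eq_bigr => b _; rewrite ltnS /G coefM leq_subLR.
have -> : Ordinal (ltn_pmod c kappa_gt0) = c.
  by apply: val_inj; rewrite /= modn_small.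
by case: (leqP b _) => _ //=; rewrite mul0r.
Qed.

Definition top_rows : 'I_kappa -> 'I_n := widen_ord le_kappan.

(** Invertibility of the top block of M(0) yields the full rank of [M] and allows the top
    coordinates of successive codeword coefficients to be prescribed. *)
Lemma det_top_neq0 : \det (rowsub top_rows (map_mx (coefp 0) M)) != 0.
Proof.
have -> : rowsub top_rows (map_mx (coefp 0) M) =
    \matrix_(i, l) gamma ^+ (2 ^ (i + (l + a))).
  by apply/matrixP => i l; rewrite !mxE /= coefM leq0n mul0n add0n addnA.
apply: (det_expn2_neq0 hp hN cardF prim (E := (mu * n + n + kappa + a)%N)) => //.
- by apply: leq_ltn_trans N_large; rewrite leq_mul2r leq_pmull ?orbT.
- by move=> i l; have := ltn_ord i; have := ltn_ord l; lia.
- by move=> l l' /addIn/val_inj.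
Qed.

Lemma full_column_rank_code : full_column_rank M.
Proof.
apply/eqP; rewrite eqn_leq rank_leq_col /=.
apply: leq_trans (rank_rowsub_leq top_rows _).
rewrite -map_mxsub mxrank_unit // unitmxE unitfE det_map_mx tofrac_eq0.
apply: contraNneq det_top_neq0 => det0.
by rewrite -map_mxsub det_map_mx det0 rmorph0.
Qed.

Lemma size_code_entry r c : (size (M r c) <= mu.+1)%N.
Proof.
by apply/leq_sizeP => i; rewrite coefM; case: leqP.
Qed.

(** This bound brings every j up to L into the range [(n - kappa) * j <= n * mu]. *)
Lemma conv_degree_leq : (conv_degree M <= kappa * mu)%N.
Proof.
apply/bigmax_leqP => f _; rewrite -ltnS.
apply: (@leq_trans (kappa * mu).+1) => //.
case: (size _) (size_det_leq (d := mu) (A := rowsub f M)) => // s.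
by apply=> i l; rewrite mxE size_code_entry.
Qed.

Lemma vcoef0_mulmx (u : 'cV[{poly F}]_kappa) :
  vcoef 0 (M *m u) = map_mx (coefp 0) M *m vcoef 0 u.
Proof. by rewrite -[vcoef 0]/(map_mx (coefp 0)) map_mxM. Qed.

Lemma column_distance_geq j w : ((n - kappa) * j <= n * mu)%N ->
  conv_code M w -> vcoef 0 w != 0 -> ((n - kappa) * j.+1 < truncated_wt j w)%N.
Proof.
move=> jmu [u ->] w0; elim/ltn_ind: j jmu => j IH jmu.
rewrite ltnNge; apply/negP => bad.
have good i : (i < j)%N ->
    ((n - kappa) * i.+1 < truncated_wt i (M *m u))%N.
  move=> ij; apply: IH => //; apply: leq_trans jmu.
  by rewrite leq_mul2l ltnW ?orbT.
have [f [f_incr f_zero f_diag]] := zero_positions n_gt0 kappan jmu good bad.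
have jle : (j <= n * mu)%N.
  by apply: leq_trans jmu; case/andP: kappan => _; rewrite -subn_gt0; apply: leq_pmull.
have detB := det_sliding_neq0 jle f_incr f_diag.
pose U : 'cV[F]_(j.+1 * kappa) := \col_c rev_flat_coef u c.
have U0 : U = 0.
  apply: (det_neq0_injective detB); apply/colP => q; rewrite !mxE.
  have [fq f0] := f_zero q; rewrite -[RHS]f0 (flat_coef_mulmx _ fq).
  by apply: eq_bigr => c _; rewrite !mxE.
move: w0; rewrite vcoef0_mulmx => /negP; apply.
(* The first block of [U] is the constant coefficient of [u] in reversed order. *)
suff -> : vcoef 0 u = 0 by rewrite mulmx0.
apply/colP => c; have c_lt : (rev_ord c < j.+1 * kappa)%N.
  by apply: leq_trans (ltn_ord _) _; rewrite mulSn leq_addr.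
move/colP/(_ (Ordinal c_lt)): U0; rewrite !mxE /rev_flat_coef.
rewrite [(_ %/ kappa)%N]divn_small; last exact: (ltn_ord (rev_ord c)).
move=> U0c; rewrite -[RHS]U0c; congr ((u _ _)`_ _).
apply: rev_ord_inj; rewrite rev_ordK; apply: val_inj.
by rewrite /= modn_small //; exact: (ltn_ord (rev_ord c)).
Qed.

Lemma hamming_wt_leq (A : {set 'I_n}) (x : 'cV[F]_n) :
  (forall r, r \in A -> x r ord0 = 0) -> (hamming_wt x <= n - #|A|)%N.
Proof.
move=> x0; rewrite -[X in (_ <= X - _)%N](card_ord n) -(cardsC A) addKn.
apply/subset_leq_card/subsetP => r; rewrite !inE.
by apply: contraNN => /x0 ->.
Qed.

(** The coefficients of [u] are chosen successively so that the top [kappa] coordinates form a unit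
    vector in w_0 and vanish in w_1, ..., w_j. The weights are then at most n - kappa + 1 and n -
    kappa. *)
Lemma column_distance_attained j : exists w,
  [/\ conv_code M w, vcoef 0 w != 0 &
      (truncated_wt j w <= (n - kappa) * j.+1 + 1)%N].
Proof.
pose M0 := map_mx (coefp 0) M; pose T := rowsub top_rows M0.
have unitT : T \in unitmx by rewrite unitmxE unitfE det_top_neq0.
pose last_c : 'I_kappa := Ordinal (eq_leq (prednK kappa_gt0)).
pose e := delta_mx last_c ord0 : 'cV[F]_kappa.
have e0 : e != 0.
  by apply/eqP => /matrixP/(_ last_c ord0)/eqP; rewrite !mxE !eqxx oner_eq0.
suff [u [u0 uS]] : exists u : 'cV[{poly F}]_kappa,
    rowsub top_rows (vcoef 0 (M *m u)) = e /\
    forall t, (0 < t <= j)%N -> rowsub top_rows (vcoef t (M *m u)) = 0.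
  exists (M *m u); split; first by exists u.
    by apply: contraNneq e0 => w0; rewrite -u0 w0; apply/eqP/matrixP => i l; rewrite !mxE.
  have topI : injective top_rows by move=> c c' /(congr1 val) /= cc'; apply: val_inj.
  rewrite /truncated_wt big_ord_recl /= mulnS addnAC leq_add //.
    have := @hamming_wt_leq (top_rows @: [set~ last_c]) (vcoef 0 (M *m u)).
    rewrite card_imset // cardsC1 card_ord => wt0; apply: leq_trans (wt0 _) _.
      move=> r /imsetP[c]; rewrite !inE => cl ->.
      by move/matrixP/(_ c ord0): u0; rewrite !mxE (negPf cl).
    by rewrite leq_subLR; lia.
  rewrite mulnC -[X in (X * _)%N](card_ord j) -sum_nat_const leq_sum // => t _.
  have := @hamming_wt_leq (top_rows @: setT) (vcoef t.+1 (M *m u)).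
  rewrite card_imset // cardsT card_ord; apply=> r /imsetP[c _ ->].
  by have /matrixP/(_ c ord0) := uS t.+1 (ltn_ord t); rewrite !mxE.
have vcoef0C (d : 'cV[F]_kappa) : vcoef 0 (M *m map_mx polyC d) = M0 *m d.
  rewrite vcoef0_mulmx; congr (_ *m _).
  by apply/matrixP => c l; rewrite !mxE coefC.
elim: j => [|j [u [u0 uS]]].
  exists (map_mx polyC (invmx T *m e)); split; last by case.
  by rewrite vcoef0C -mul_rowsub_mx mulKVmx.
(* A correction of order [j.+1] keeps the earlier coefficients and cancels the top coordinates of
   the next one. *)
pose d := - (invmx T *m rowsub top_rows (vcoef j.+1 (M *m u))).
exists (u + 'X^(j.+1) *: map_mx polyC d).
have shift t : (t <= j.+1)%N ->
    vcoef t (M *m (u + 'X^(j.+1) *: map_mx polyC d)) =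
    vcoef t (M *m u) + (if (t == j.+1)%N then M0 *m d else 0).
  move=> tj; rewrite mulmxDr -scalemxAr; apply/matrixP => r l.
  have e1 x (i : 'I_1) : vcoef t x r i = (x r i)`_t by rewrite mxE.
  rewrite mxE [in RHS]mxE e1 mxE coefD; congr (_ + _).
  rewrite mxE coefXnM ltn_neqAle tj andbT -vcoef0C.
  by case: eqP => [->|_] /=; rewrite ?subnn [RHS]mxE.
split=> [|t /andP[t0 tj]]; first by rewrite shift // addr0.
rewrite shift //; case: eqP => [->|/eqP tj'].
  rewrite (_ : rowsub _ (_ + _) = rowsub top_rows (vcoef j.+1 (M *m u)) +
    rowsub top_rows (M0 *m d)); last by apply/matrixP => r l; rewrite !mxE.
  by rewrite -mul_rowsub_mx mulmxN mulKVmx // subrr.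
by rewrite addr0 uS // t0 -ltnS ltn_neqAle tj'.
Qed.

Lemma generates_MDP_exponential : generates_MDP_code M.
Proof.
split; first exact: full_column_rank_code.
move=> j j_le; have jmu : ((n - kappa) * j <= n * mu)%N.
  have := conv_degree_leq; move: (conv_degree M) j_le => d j_le d_le.
  have nk0 : (0 < n - kappa)%N by rewrite subn_gt0; case/andP: kappan.
  have d1 : (d %/ kappa <= mu)%N by rewrite -(mulKn mu kappa_gt0) leq_div2r.
  have d2 := leq_divM d (n - kappa).
  (* (n - kappa) L <= (n - kappa) mu + d <= (n - kappa) mu + kappa mu = n mu. *)
  have /(leq_trans _) : ((n - kappa) * (d %/ kappa + d %/ (n - kappa)) <= n * mu)%N.
    rewrite mulnDr [X in (_ + X)%N]mulnC.
    apply: (@leq_trans ((n - kappa) * mu + kappa * mu)).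
      by rewrite leq_add ?(leq_trans d2) // leq_mul2l d1 orbT.
    by rewrite -mulnDl subnK.
  by apply; rewrite leq_mul2l j_le orbT.
split=> [|w Mw w0]; last by rewrite addn1 column_distance_geq.
have [w [Mw w0 wt_le]] := column_distance_attained j.
exists w; split=> //; apply/eqP; rewrite eqn_leq wt_le.
by rewrite addn1 column_distance_geq.
Qed.

End ExponentialCode.

(** * Degrees of matrix-vector products *)

Lemma coefM_top (R : nzSemiRingType) d e (p q : {poly R}) :
  (size p <= d.+1)%N -> (size q <= e.+1)%N -> (p * q)`_(e + d) = p`_d * q`_e.
Proof.
move=> sp sq; have e_lt : (e < (e + d).+1)%N by rewrite ltnS leq_addr.
rewrite coefMr (bigD1 (Ordinal e_lt)) //= addKn big1 ?addr0 // => b.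
rewrite -val_eqE neq_ltn => /orP[] /= ltb.
  by rewrite nth_default ?mul0r //; apply: leq_trans sp _; lia.
by rewrite [q`__]nth_default ?mulr0 //; apply: leq_trans sq _.
Qed.

Section VectorDegree.

Variable R : idomainType.

(** Over a general domain: R = {poly F} gives [degz2], while R = F serves the coefficient
    matrices. *)
Definition vdeg a (v : 'cV[{poly R}]_a) : nat :=
  \max_(r < a) (size (v r ord0)).-1.

Lemma size_vdeg a (v : 'cV[{poly R}]_a) r : (size (v r ord0) <= (vdeg v).+1)%N.
Proof.
apply: leq_trans (leqSpred _) _; rewrite ltnS.
exact: (@leq_bigmax _ (fun r => (size (v r ord0)).-1)).
Qed.

Lemma vdeg_coef_neq0 a (v : 'cV[{poly R}]_a) :
  v != 0 -> map_mx (coefp (vdeg v)) v != 0.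
Proof.
move=> v0; have [r0 vr0] : exists r, v r ord0 != 0.
  apply/existsP; apply: contraR v0; rewrite negb_exists => /forallP v0.
  by apply/eqP/colP => r; rewrite mxE; apply/eqP; have := v0 r; rewrite negbK.
case: (@arg_maxnP _ r0 xpredT (fun r => size (v r ord0)) isT) => r _ rmax.
have vr : v r ord0 != 0.
  by rewrite -size_poly_gt0; apply: leq_trans (rmax r0 isT); rewrite size_poly_gt0.
have -> : vdeg v = (size (v r ord0)).-1.
  apply/eqP; rewrite eqn_leq; apply/andP; split.
    by apply/bigmax_leqP => r' _; rewrite -!subn1 leq_sub2r //; apply: rmax.
  exact: (@leq_bigmax _ (fun r => (size (v r ord0)).-1)).
apply: contraNneq vr => /colP/(_ r); rewrite !mxE /= => /eqP.
by rewrite -/(lead_coef _) lead_coef_eq0.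
Qed.

Variables (a b d : nat) (A : 'M[{poly R}]_(a, b)).
Hypothesis size_A : forall r c, (size (A r c) <= d.+1)%N.
Hypothesis lead_inj : forall x : 'cV[R]_b, map_mx (coefp d) A *m x = 0 -> x = 0.

Lemma coef_mulmx_top (u : 'cV[{poly R}]_b) :
  map_mx (coefp (vdeg u + d)) (A *m u) =
  map_mx (coefp d) A *m map_mx (coefp (vdeg u)) u.
Proof.
apply/colP => r; rewrite !mxE /= coef_sum; apply: eq_bigr => c _.
by rewrite !mxE /= coefM_top ?size_vdeg.
Qed.

(** Passing injectivity from the leading coefficient to [A] allows the two variables to be treated
    one after the other. *)
Lemma mulmx_lead_inj (u : 'cV[{poly R}]_b) : A *m u = 0 -> u = 0.
Proof.
move=> Au; apply/eqP; apply: contraT => /vdeg_coef_neq0/eqP; case.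
by apply: lead_inj; rewrite -coef_mulmx_top Au map_mx0.
Qed.

Lemma vdeg_mulmx (u : 'cV[{poly R}]_b) :
  u != 0 -> vdeg (A *m u) = (vdeg u + d)%N.
Proof.
move=> u0; apply/eqP; rewrite eqn_leq; apply/andP; split.
  apply/bigmax_leqP => r _; rewrite -ltnS.
  suff : (size ((A *m u) r ord0) <= (vdeg u + d).+1)%N by case: (size _).
  rewrite mxE; apply: leq_trans (size_sum _ _ _) _; apply/bigmax_leqP => c _.
  apply: leq_trans (size_polyMleq _ _) _.
  rewrite -subn1 leq_subLR; apply: leq_trans (leq_add (size_A r c) (size_vdeg u c)) _; lia.
rewrite leqNgt; apply/negP => lt_deg.
have /eqP[] := vdeg_coef_neq0 u0; apply: lead_inj; rewrite -coef_mulmx_top.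
apply/colP => r; rewrite [LHS]mxE [RHS]mxE /= nth_default //.
by apply: leq_trans (size_vdeg _ _) _.
Qed.

End VectorDegree.

Section BivariateDegree.

Variables (F : fieldType) (a b : nat).

(** The leading coefficient in the outer variable is injective over {poly F} because its own leading
    coefficient, [coef2 d1 d2 A], is injective over F. *)
Lemma vdeg_mulmx2 d1 d2 (A : 'M[{poly {poly F}}]_(a, b))
    (u : 'cV[{poly {poly F}}]_b) :
  (forall i l r c, (d1 < i)%N || (d2 < l)%N -> (A r c)`_l`_i = 0) ->
  (forall x : 'cV[F]_b, coef2 d1 d2 A *m x = 0 -> x = 0) ->
  u != 0 -> vdeg (A *m u) = (vdeg u + d2)%N.
Proof.
move=> A0 A_inj; apply: vdeg_mulmx => [r c|].
  by apply/leq_sizeP => l dl; apply/polyP => i; rewrite coef0 A0 ?dl ?orbT.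
apply: (@mulmx_lead_inj _ _ _ d1) => [r c|x].
  by apply/leq_sizeP => i di; rewrite mxE /= A0 ?di.
suff -> : map_mx (coefp d1) (map_mx (coefp d2) A) = coef2 d1 d2 A by apply: A_inj.
by apply/matrixP => r c; rewrite !mxE.
Qed.

Lemma degz1E c (v : 'cV[{poly {poly F}}]_c) :
  degz1 v = vdeg (map_mx (@swapXY F) v).
Proof. by apply: eq_bigr => r _; rewrite mxE sizeYE. Qed.

(** Beyond degree [d] every component is received unerased as 0, so it vanishes in [v] as well. *)
Lemma degz1_leq_received c (v : 'cV[{poly {poly F}}]_c) vh d :
  erasure_of v vh -> has_degz1 vh d -> (degz1 v <= d)%N.
Proof.
move=> er [_ vh0]; apply/bigmax_leqP => r _.
suff : (size (swapXY (v r ord0)) <= d.+1)%N by rewrite sizeYE; lia.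
apply/leq_sizeP => i di; apply/polyP => j; rewrite coef0 coef_swapXY.
by case: (er i j r); rewrite (vh0 i j r di) // => -[]; rewrite mxE.
Qed.

Lemma degz2_leq_received c (v : 'cV[{poly {poly F}}]_c) vh d :
  erasure_of v vh -> has_degz2 vh d -> (degz2 v <= d)%N.
Proof.
move=> er [_ vh0]; apply/bigmax_leqP => r _.
suff : (size (v r ord0) <= d.+1)%N by lia.
apply/leq_sizeP => j dj; apply/polyP => i; rewrite coef0.
by case: (er i j r); rewrite (vh0 i j r dj) // => -[]; rewrite mxE.
Qed.

End BivariateDegree.

(** * Coefficients of the construction *)

Section ConstructionCoefficients.

Lemma coef_matrix_poly (R : nzRingType) a b d (A : 'I_d -> 'M[R]_(a, b)) r c t :
  ((\sum_(l < d) 'X^l *: map_mx polyC (A l)) r c)`_t =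
  \sum_(l < d | val l == t) A l r c.
Proof.
rewrite summxE coef_sum [RHS]big_mkcond; apply: eq_bigr => l _.
by rewrite !mxE coefMC coefXn eq_sym; case: eqP; rewrite ?mul1r ?mul0r.
Qed.

Variables (F : finFieldType) (n k mu1 mu2 : nat) (gamma : F).

Lemma coef_frakG1 r c i : (frakG1 n k mu1 mu2 gamma r c)`_i =
  if (i <= mu1)%N then gamma ^+ (2 ^ (i * n + r + c)) else 0.
Proof.
rewrite coef_matrix_poly; case: leqP => [i_le|lt_i].
  by rewrite (big_pred1 (Ordinal (i_le : (i < mu1.+1)%N))) ?mxE.
by rewrite big1 // => l /eqP il; have := ltn_ord l; rewrite il ltnS leqNgt lt_i.
Qed.

Lemma coef_G2D i l r c : (G2D n k mu1 mu2 gamma r c)`_l`_i =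
  if (i <= mu1)%N && (l <= mu2)%N
  then gamma ^+ (2 ^ (i * n + r + (l * k + c))) else 0.
Proof.
rewrite coef_matrix_poly andbC; case: leqP => [l_le|lt_l] /=.
  by rewrite (big_pred1 (Ordinal (l_le : (l < mu2.+1)%N))) // mxE coef_frakG1.
rewrite big1 ?coef0 // => m /eqP ml.
by have := ltn_ord m; rewrite ml ltnS leqNgt lt_l.
Qed.

Lemma tagnat_sum_const m (c : 'I_(\sum_(i < m) k)) :
  (tagnat.sig1 c * k + tagnat.sig2 c)%N = c.
Proof.
rewrite [RHS]tagnat.rect -(big_ord_widen m (fun _ => k)) ?sum_nat_const ?card_ord //.
exact: ltnW.
Qed.

Lemma coef_G1_blocks (s l : 'I_mu2.+1) r c i : (s <= l)%N ->
  (G1_blocks n k mu1 gamma s l r c)`_i =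
  if (i <= mu1)%N then gamma ^+ (2 ^ (i * n + r + c + s * k)) else 0.
Proof.
move=> sl; rewrite mxE mxE coef_frakG1 /= inordK; last first.
  by have := ltn_ord (tagnat.sig1 c); have := ltn_ord l; lia.
rewrite -[in RHS](tagnat_sum_const c) mulnDl.
by congr (if _ then _ ^+ (2 ^ _) else _); lia.
Qed.

Lemma Gcoef_rowE r c : Gcoef_row n k mu1 mu2 gamma r c =
  gamma ^+ (2 ^ (r + (tagnat.sig1 (tagnat.sig2 c) * n +
    (tagnat.sig1 c * k + tagnat.sig2 (tagnat.sig2 c))))).
Proof.
rewrite mxE mxE mxE coef_G2D -(ltnS _ mu1) -(ltnS _ mu2) !ltn_ord /=.
by congr (_ ^+ (2 ^ _)); lia.
Qed.

(** In i n + (l k + c) one has l k + c < khat <= n, so division by n recovers i, and division by k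
    then recovers l and c. For mu1 = 0 the only i is 0. *)
Lemma Gcoef_col_inj : ((0 < mu1)%N -> (khat k mu2 <= n)%N) ->
  injective (fun c : 'I_(\sum_(l < mu2.+1) \sum_(i < mu1.+1) k) =>
    tagnat.sig1 (tagnat.sig2 c) * n +
    (tagnat.sig1 c * k + tagnat.sig2 (tagnat.sig2 c)))%N.
Proof.
move=> khat_le c c' /= eq_c.
have lt_l (z : 'I_(\sum_(l < mu2.+1) \sum_(i < mu1.+1) k)) :
    (tagnat.sig1 z * k + tagnat.sig2 (tagnat.sig2 z) < khat k mu2)%N.
  exact: (block_col_subproof (tagnat.sig1 z) (tagnat.sig2 (tagnat.sig2 z))).
have eq_divmod d x y x' y' : (y < d)%N -> (y' < d)%N ->
    (x * d + y = x' * d + y')%N -> x = x' /\ y = y'.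
  move=> yd y'd e; have d0 : (0 < d)%N by apply: leq_ltn_trans yd.
  split; first by have := congr1 (divn^~ d) e; rewrite !divnMDl // !divn_small // !addn0.
  by have := congr1 (modn^~ d) e; rewrite !modnMDl !modn_small.
have [e1 e2] : tagnat.sig1 (tagnat.sig2 c) = tagnat.sig1 (tagnat.sig2 c') :> nat /\
   (tagnat.sig1 c * k + tagnat.sig2 (tagnat.sig2 c) =
    tagnat.sig1 c' * k + tagnat.sig2 (tagnat.sig2 c'))%N.
  have [mu0|mu_gt0] := posnP mu1.
    have z0 (z : 'I_(\sum_(l < mu2.+1) \sum_(i < mu1.+1) k)) :
        tagnat.sig1 (tagnat.sig2 z) = 0%N :> nat.
      by apply/eqP; rewrite -leqn0 -{2}mu0 -ltnS ltn_ord.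
    by move: eq_c; rewrite !z0.
  by apply: (eq_divmod n) => //; apply: leq_trans (lt_l _) (khat_le mu_gt0).
have [e3 e4] := eq_divmod k _ _ _ _ (ltn_ord _) (ltn_ord _) e2.
apply: val_inj; rewrite /= -(tagnat.sig2K c) -(tagnat.sig2K c').
apply/eqP; rewrite tagnat.eq_Rank; apply/andP; split; first exact/eqP/val_inj.
rewrite -(tagnat.sig2K (tagnat.sig2 c)) -(tagnat.sig2K (tagnat.sig2 c')).
by rewrite tagnat.eq_Rank; apply/andP; split; apply/eqP; first exact: val_inj.
Qed.

End ConstructionCoefficients.

Lemma increasing_inj a b (f : 'I_a -> 'I_b) : increasing f -> injective f.
Proof.
move=> /forallP incr x y eq_f; apply: val_inj.
have lt_f (x' y' : 'I_a) : (x' < y')%N -> (f x' < f y')%N.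
  by apply/implyP; have /forallP := incr x'; apply.
by case: (ltngtP x y) => // /lt_f; rewrite eq_f ltnn.
Qed.

Theorem mainTheorem5 (n k mu1 mu2 p : nat)
    (hk : (0 < k)%N) (hn : (2 * k < n)%N) (hp : prime p) :
  exists N0 : nat, forall N : nat, (N0 <= N)%N ->
  forall (F : finFieldType) (gamma : F),
    #|F| = (p ^ N)%N -> (#|F|.-1).-primitive_root gamma ->
  [/\ (* (1) An (n, kappa) code has a distance profile when kappa < n. *)
      forall s l : 'I_mu2.+1, (s <= l)%N -> ((l - s).+1 * k < n)%N ->
        generates_MDP_code (G1_blocks n k mu1 gamma s l),
      (* (2) If 0 < mu1 and n < khat then G_00 and its successors contain two
         equal columns, so that some full size minor vanishes. *)
      ((0 < mu1)%N -> (khat k mu2 <= n)%N) ->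
        nonzero_full_size_minors (Gcoef_row n k mu1 mu2 gamma)
    & (* (3) *)
      \rank (Gcoef n k mu1 mu2 gamma mu1 mu2) = minn n k /\
      forall (u : 'cV[{poly {poly F}}]_k) (vh : received_word F n) (d1 d2 : nat),
        let v := G2D n k mu1 mu2 gamma *m u in
        u != 0 -> erasure_of v vh -> has_degz1 vh d1 -> has_degz2 vh d2 ->
        ((degz1 u)%:Z = (degz1 v)%:Z - mu1%:Z /\
         (degz1 v)%:Z - mu1%:Z <= d1%:Z - mu1%:Z) /\
        ((degz2 u)%:Z = (degz2 v)%:Z - mu2%:Z /\
         (degz2 v)%:Z - mu2%:Z <= d2%:Z - mu2%:Z)].
Proof.
(* The minors have size at most (n mu1 + 1) n and entries of degree at most 2^(mu1 n + n + khat) in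
   [gamma]; the two successors also give [1 < N]. *)
exists (((n * mu1).+1 * n * 2 ^ (mu1 * n + n + khat k mu2)).+2) => N N_ge F gamma.
move=> cardF prim; have N_gt1 : (1 < N)%N by apply: leq_trans N_ge.
have N_big : ((n * mu1).+1 * n * 2 ^ (mu1 * n + n + khat k mu2) < N)%N.
  exact: ltnW.
have small m : (m <= n)%N -> (m * 2 ^ (mu1 * n + n + khat k mu2) < N)%N.
  move=> mn; apply: leq_ltn_trans N_big; rewrite leq_mul2r; apply/orP; right.
  by apply: leq_trans mn _; rewrite leq_pmull.
split.
- move=> s l sl kappa_lt.
  have kappaE : (\sum_(i < (l - s).+1) k)%N = ((l - s).+1 * k)%N.
    by rewrite sum_nat_const card_ord.
  (* The shift [a] is the index of the first column of block [s]. *)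
  apply: (generates_MDP_exponential hp N_gt1 cardF prim (mu := mu1) (a := (s * k)%N)).
  + by rewrite kappaE kappa_lt muln_gt0 hk.
  + by move=> r c i; apply: coef_G1_blocks.
  apply: leq_ltn_trans N_big; rewrite leq_mul //.
    by rewrite leq_mul2l kappaE ltnW ?orbT.
  rewrite leq_pexp2l // -addnA leq_add2l kappaE -mulnDl leq_mul2r.
  by apply/orP; right; have := ltn_ord l; lia.
- move=> khat_le f g f_incr g_incr.
  pose q c := (tagnat.sig1 (tagnat.sig2 (g c)) * n +
    (tagnat.sig1 (g c) * k + tagnat.sig2 (tagnat.sig2 (g c))))%N.
  have -> : mxsub f g (Gcoef_row n k mu1 mu2 gamma) =
      \matrix_(i, c) gamma ^+ (2 ^ (f i + q c)).
    by apply/matrixP => i c; rewrite [LHS]mxE Gcoef_rowE [RHS]mxE.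
  apply: (det_expn2_neq0 hp N_gt1 cardF prim (small _ (geq_minl _ _))).
  + move=> i c; rewrite /q.
    have := block_col_subproof (tagnat.sig1 (g c)) (tagnat.sig2 (tagnat.sig2 (g c))).
    have := ltn_ord (f i).
    have : (tagnat.sig1 (tagnat.sig2 (g c)) * n <= mu1 * n)%N.
      by rewrite leq_mul2r -ltnS ltn_ord orbT.
    by lia.
  + move=> i i'; have /forallP/(_ i)/forallP/(_ i') := f_incr.
    by move/implyP.
  + by move=> c c' /(Gcoef_col_inj khat_le) /(increasing_inj g_incr).
have kn : (k <= n)%N by lia.
set A := Gcoef _ _ _ _ _ _ _.
have coefA r c : A r c = gamma ^+ (2 ^ (r + (mu1 * n + (mu2 * k + c)))).
  by rewrite mxE coef_G2D !leqnn /=; congr (_ ^+ (2 ^ _)); lia.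
have detA : \det (rowsub (widen_ord kn) A) != 0.
  have -> : rowsub (widen_ord kn) A =
      \matrix_(i, c) gamma ^+ (2 ^ (i + (mu1 * n + (mu2 * k + c)))).
    by apply/matrixP => i c; rewrite [LHS]mxE coefA [RHS]mxE.
  apply: (det_expn2_neq0 hp N_gt1 cardF prim (small _ kn)) => //.
    by move=> i c; rewrite /khat mulSn; have := ltn_ord i; have := ltn_ord c; lia.
  by move=> c c' /= /addnI/addnI/val_inj.
split.
  apply/eqP; rewrite (minn_idPr kn) eqn_leq rank_leq_col /=.
  apply: leq_trans (rank_rowsub_leq (widen_ord kn) _).
  by rewrite mxrank_unit // unitmxE unitfE.
have A_inj (x : 'cV[F]_k) : A *m x = 0 -> x = 0.
  move=> Ax; apply: (det_neq0_injective detA).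
  by rewrite mul_rowsub_mx Ax; apply/matrixP => i c; rewrite !mxE.
move=> u vh d1 d2 v u0 er deg1 deg2.
have v2 : degz2 v = (degz2 u + mu2)%N.
  apply: (@vdeg_mulmx2 F n k mu1 mu2) => // i l r c lt_il.
  by rewrite coef_G2D (leqNgt _ mu1) (leqNgt _ mu2) -negb_or lt_il.
(* Swapping the variables reduces this to the degree in the outer variable; the swap is an
   involution, so it keeps [u] nonzero. *)
have v1 : degz1 v = (degz1 u + mu1)%N.
  rewrite !degz1E map_mxM; apply: (@vdeg_mulmx2 F n k mu2 mu1).
  - move=> i l r c lt_il.
    by rewrite mxE coef_swapXY coef_G2D (leqNgt _ mu1) (leqNgt _ mu2) -negb_or orbC lt_il.
  - move=> x; suff -> : coef2 mu2 mu1 (map_mx (@swapXY F) (G2D n k mu1 mu2 gamma)) = A.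
      exact: A_inj.
    by apply/matrixP => r c; rewrite !mxE coef_swapXY.
  apply: contraNneq u0 => swu0; apply/eqP/colP => c; rewrite mxE -[LHS]swapXYK.
  by move/colP/(_ c): swu0; rewrite !mxE => ->; rewrite rmorph0.
have := degz1_leq_received er deg1; have := degz2_leq_received er deg2.
by split; split; lia.
Qed.
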